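(* Let $G$ be a graph of order $n\geq 2$ and $\overline{G}$ its complement. If $k=2$, then $3\leq \gamma^r_2(G)+\gamma^r_2(\overline{G})\leq 2n-1$ and $2\leq \gamma^r_2(G)\cdot\gamma^r_2(\overline{G})\leq n(n-1)$; the lower bounds are attained if and only if $G\in\{K_2,\overline{K}_2,P_3,\overline{P}_3\}$, and the upper bounds are attained if and only if $G\in\{K_n,\overline{K}_n\}$. If $k\geq 3$, then $2\leq \gamma^r_k(G)+\gamma^r_k(\overline{G})\leq 2n-1$ and $1\leq \gamma^r_k(G)\cdot\gamma^r_k(\overline{G})\leq n(n-1)$; the lower bounds are attained if and only if $G\cong P_4$, and the upper bounds are attained if and only if $G\in\{K_n,\overline{K}_n\}$.
   Context: $P_m$ is the path on $m$ vertices, $K_m$ the complete graph, $\overline{K}_m$ the edgeless graph. For a graph $G=(V,E)$ (not necessarily connected; distances between vertices in different components are $\infty$) and $k\geq 1$, a set $D\subseteq V$ is distance $k$-dominating if every $v\in V\setminus D$ is at distance at most $k$ from some vertex of $D$. An ordered set $W=\{w_1,\dots,w_r\}$ is a resolving set if for all distinct $u,v\in V\setminus W$ the distance vectors $(d_G(u,w_i))_i$ and $(d_G(v,w_i))_i$ differ. $\gamma^r_k(G)$ is the minimum cardinality of a set that is both resolving and distance $k$-dominating. *)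

(* Defs.v *)
From mathcomp Require Import all_boot.

Set Implicit Arguments.
Unset Strict Implicit.
Unset Printing Implicit Defensive.

Record sgraph := SGraph {
  svertex :> finType;
  adj : rel svertex;
  adj_sym : symmetric adj;
  adj_irr : irreflexive adj }.

Definition isomorphic (G H : sgraph) : Prop :=
  exists2 f : G -> H, bijective f & forall x y, adj (f x) (f y) = adj x y.

Section Complement.
Variable G : sgraph.

Definition compl_adj (x y : G) := (x != y) && ~~ adj x y.

Fact compl_adj_sym : symmetric compl_adj.
Proof. by move=> x y; rewrite /compl_adj eq_sym adj_sym. Qed.

Fact compl_adj_irr : irreflexive compl_adj.
Proof. by move=> x; rewrite /compl_adj eqxx. Qed.

Definition compl_graph := SGraph compl_adj_sym compl_adj_irr.

End Complement.

Section Families.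
Variable m : nat.

Definition complete_adj (i j : 'I_m) := i != j.

Fact complete_adj_sym : symmetric complete_adj.
Proof. by move=> i j; rewrite /complete_adj eq_sym. Qed.

Fact complete_adj_irr : irreflexive complete_adj.
Proof. by move=> i; rewrite /complete_adj eqxx. Qed.

Definition complete_graph := SGraph complete_adj_sym complete_adj_irr.

Definition edgeless_adj (i j : 'I_m) := false.

Fact edgeless_adj_sym : symmetric edgeless_adj.
Proof. by []. Qed.

Fact edgeless_adj_irr : irreflexive edgeless_adj.
Proof. by []. Qed.

Definition edgeless_graph := SGraph edgeless_adj_sym edgeless_adj_irr.

Definition path_adj (i j : 'I_m) := (i.+1 == j :> nat) || (j.+1 == i :> nat).

Fact path_adj_sym : symmetric path_adj.
Proof. by move=> i j; rewrite /path_adj orbC. Qed.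

Fact path_adj_irr : irreflexive path_adj.
Proof. by move=> i; rewrite /path_adj orbb gtn_eqF. Qed.

Definition path_graph := SGraph path_adj_sym path_adj_irr.

End Families.

Section Distance.
Variable G : sgraph.
Implicit Types (x y u v w : G) (D W : {set G}).

Definition has_walk x y (d : nat) : bool :=
  [exists p : d.-tuple G, path (@adj G) x p && (last x p == y)].

Fact connect_walk x y : connect (@adj G) x y -> exists d, has_walk x y d.
Proof.
case/connectP=> p px ->; exists (size p).
by apply/existsP; exists (in_tuple p); rewrite px eqxx.
Qed.

(* The infinite distance is None. *)
Definition dist x y : option nat :=
  if decP (@idP (connect (@adj G) x y)) is left xy
  then Some (ex_minn (connect_walk xy)) else None.

Definition dist_le (d : option nat) (k : nat) : bool :=
  if d is Some m then m <= k else false.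

Definition dominating (k : nat) D : bool :=
  [forall v in ~: D, [exists w in D, dist_le (dist v w) k]].

(* The order in which enum lists W is immaterial: whether two distance vectors
   differ does not depend on it. *)
Definition dist_vector W u : seq (option nat) := [seq dist u w | w <- enum W].

Definition resolving W : bool :=
  [forall u in ~: W, [forall v in ~: W,
    (u != v) ==> (dist_vector W u != dist_vector W v)]].

Definition res_dominating (k : nat) D : bool := resolving D && dominating k D.

Fact res_dominatingT k : res_dominating k [set: G].
Proof.
by apply/andP; split; apply/forall_inP=> u; rewrite setCT inE.
Qed.

(* By res_dominatingT the minimum is over a nonempty family. *)
Definition gamma_r (k : nat) : nat :=
  #|[arg min_(D < [set: G] | res_dominating k D) #|D| ]|.

Lemma dist_None x y : (dist x y = None) <-> ~~ connect (@adj G) x y.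
Proof.
by rewrite /dist; case: decP => [xy | /negP xy]; split=> //; rewrite xy.
Qed.

Lemma dist_Some x y d :
  dist x y = Some d <->
  has_walk x y d /\ forall e, has_walk x y e -> d <= e.
Proof.
rewrite /dist; case: decP => xy.
  case: ex_minnP => m hm minm; split=> [[<-]|[hd mind]] //.
  by congr Some; apply/eqP; rewrite eqn_leq minm // mind.
split=> // -[/existsP[p /andP[px /eqP py]] _]; case: xy.
by apply/connectP; exists p.
Qed.

Lemma gamma_rP k :
  (exists2 D, res_dominating k D & #|D| = gamma_r k)
  /\ forall D, res_dominating k D -> gamma_r k <= #|D|.
Proof.
rewrite /gamma_r; case: arg_minnP => [|D hD minD]; first exact: res_dominatingT.
by split=> //; exists D.
Qed.

End Distance.

(* Main.v *)
Require Import Defs.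
From mathcomp Require Import all_boot.
From mathcomp Require Import zify.

Set Implicit Arguments.
Unset Strict Implicit.
Unset Printing Implicit Defensive.

(** A set omitting a single non-isolated vertex is resolving and dominating, so
    gamma = n exactly for edgeless graphs, while in a complete graph all
    distances are equal and a resolving set omits at most one vertex; this gives
    the upper bounds.  A single vertex w is resolving and distance k-dominating
    iff v |-> d(v, w) is injective with values at most k; since every value
    below an attained distance is attained, this map is then an isomorphism onto
    the path with end w.  Finally, the only n >= 2 for which a graph and its
    complement can both be paths on n vertices is n = 4: for n <= 3 some vertex
    is adjacent to all others, and for n >= 5 an end has degree at least 3 in
    the complement. *)

(** * Walks and distances *)

Section Walks.
Variable G : sgraph.
Implicit Types x y z u v w : G.

Lemma has_walk0 x y : has_walk x y 0 = (x == y).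
Proof.
apply/existsP/idP=> [[p]|/eqP ->]; first by rewrite (tuple0 p).
by exists [tuple]; rewrite /= eqxx.
Qed.

Lemma has_walkS x y d :
  has_walk x y d.+1 <-> exists2 z, adj x z & has_walk z y d.
Proof.
split=> [/existsP[p]|[z xz /existsP[p pP]]].
  case/tupleP: p => z p /= /andP[/andP[xz pz] pl].
  by exists z => //; apply/existsP; exists p; rewrite pz.
by apply/existsP; exists [tuple of z :: p]; rewrite /= xz.
Qed.

Lemma has_walk_connect x y d : has_walk x y d -> connect (@adj G) x y.
Proof. by case/existsP=> p /andP[px /eqP pl]; apply/connectP; exists p. Qed.

Lemma has_walk_dist x y d :
  has_walk x y d -> exists2 e, dist x y = Some e & e <= d.
Proof.
move=> xy; case E: (dist x y) => [e|]; last first.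
  by move/dist_None: E; rewrite (has_walk_connect xy).
by exists e => //; case/dist_Some: E => _; apply.
Qed.

Lemma distxx x : dist x x = Some 0.
Proof. by apply/dist_Some; rewrite has_walk0. Qed.

Lemma dist_eq0 x y : dist x y = Some 0 -> x = y.
Proof. by case/dist_Some; rewrite has_walk0 => /eqP. Qed.

(** Dropping the first step of a shortest walk leaves a shortest walk, since a shorter one from [z]
    would also shorten the original. Iterated, this attains every value below a given distance. *)
Lemma distS x y d :
  dist x y = Some d.+1 -> exists2 z, adj x z & dist z y = Some d.
Proof.
case/dist_Some=> /has_walkS[z xz zy] mind; exists z => //.
apply/dist_Some; split=> // e ze; rewrite -ltnS; apply: mind.
by apply/has_walkS; exists z.
Qed.

Lemma dist_adj x z y d :
  adj x z -> dist z y = Some d -> exists2 e, dist x y = Some e & e <= d.+1.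
Proof.
move=> xz /dist_Some[zy _]; apply: has_walk_dist.
by apply/has_walkS; exists z.
Qed.

Lemma dist_edge x y : adj x y -> dist x y = Some 1.
Proof.
move=> xy; have [e E] := dist_adj xy (distxx y); rewrite E.
by case: e E => [/dist_eq0 Exy|[]//]; rewrite Exy adj_irr in xy.
Qed.

End Walks.

(** * Extreme values of gamma *)

Definition edgeless (G : sgraph) := forall x y : G, ~~ adj x y.

Definition complete (G : sgraph) := forall x y : G, x != y -> adj x y.

Section Extremes.
Variables (G : sgraph) (k : nat).
Implicit Types x y u v w : G.

Lemma gamma_r_le_card : gamma_r G k <= #|G|.
Proof. exact: max_card. Qed.

Lemma gamma_r_gt0 : 0 < #|G| -> 0 < gamma_r G k.
Proof.
case/card_gt0P=> x _; have [[D /andP[_ domD] <-] _] := gamma_rP G k.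
case: (boolP (x \in D)) => [xD|xD]; first by apply/card_gt0P; exists x.
have /forall_inP/(_ x) := domD; rewrite inE => /(_ xD)/exists_inP[w wD _].
by apply/card_gt0P; exists w.
Qed.

Lemma gamma_r_edge x y : 0 < k -> adj x y -> gamma_r G k <= #|G|.-1.
Proof.
move=> k0 xy; rewrite -(cardsC1 x); have [_ ->//] := gamma_rP G k.
apply/andP; split.
  apply/forall_inP=> u; rewrite !inE negbK => /eqP->; apply/forall_inP=> v.
  by rewrite !inE negbK => /eqP->; rewrite eqxx.
apply/forall_inP=> u; rewrite !inE negbK => /eqP->.
apply/exists_inP; exists y; last by rewrite (dist_edge xy).
by rewrite !inE; apply: contraTneq xy => ->; rewrite adj_irr.
Qed.

(** No vertex outside [D] is at finite distance from [D]: a positive finite distance needs a first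
    edge. *)
Lemma gamma_r_edgeless : edgeless G -> gamma_r G k = #|G|.
Proof.
move=> eG; have [[D /andP[_ domD] <-] _] := gamma_rP G k.
suff ->: D = [set: G] by rewrite cardsT.
apply/setP=> x; rewrite inE; apply: contraT => xD.
have /forall_inP/(_ x) := domD; rewrite inE => /(_ xD)/exists_inP[w wD].
case E: (dist x w) => [[|d]|] // _.
  by rewrite (dist_eq0 E) wD in xD.
by case: (distS E) => z; rewrite (negPf (eG _ _)).
Qed.

Lemma gamma_r_complete :
  0 < k -> 1 < #|G| -> complete G -> gamma_r G k = #|G|.-1.
Proof.
move=> k0 G1 cG; apply/eqP; rewrite eqn_leq; apply/andP; split.
  by have /card_gt1P[x [y [_ _ /cG/gamma_r_edge->]]] := G1.
have [[D /andP[resD _] <-] _] := gamma_rP G k.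
suff: #|~: D| <= 1 by have := cardsC D; lia.
apply/card_le1P=> u uD v; rewrite !inE; apply/idP/eqP=> [vD|->]; last first.
  by rewrite !inE in uD.
apply/eqP; apply: contraT => vu.
(* Two distinct vertices outside [D] are at distance 1 from all of [D], so their vectors agree. *)
have /forall_inP/(_ u uD)/forall_inP/(_ v) := resD.
rewrite inE eq_sym vu => /(_ vD)/negP; case; apply/eqP/eq_in_map => w.
rewrite mem_enum inE in uD * => wD.
have neqw z : z \notin D -> z != w by apply: contraNneq => ->.
by rewrite !dist_edge //; apply/cG/neqw.
Qed.

Lemma gamma_r_eq_card :
  0 < k -> 0 < #|G| -> gamma_r G k = #|G| <-> edgeless G.
Proof.
move=> k0 G0; split=> [E x y|]; last exact: gamma_r_edgeless.
by apply/negP=> /(gamma_r_edge k0); rewrite E; lia.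
Qed.

End Extremes.

(** * Graphs with gamma equal to one *)

Lemma isomorphic_card (G H : sgraph) : isomorphic G H -> #|G| = #|H|.
Proof. by case=> f /bij_eq_card. Qed.

Section Paths.
Variables (G : sgraph) (n : nat).
Hypothesis Gn : #|G| = n.

Lemma dist_path (f : G -> path_graph n) (w : G) :
    bijective f -> (forall x y, adj (f x) (f y) = adj x y) -> f w = 0 :> nat ->
  forall v, dist v w = Some (f v : nat).
Proof.
move=> [g fK gK] fadj fw0 v; apply/dist_Some; split.
  (* A walk of length [f v] lowers the index by one at each step. *)
  move: {2}(f v : nat) (erefl (f v : nat)) => d; elim: d v => [|d IH] v E.
    by rewrite E has_walk0; apply/eqP/(can_inj fK)/val_inj; apply: etrans E (esym fw0).
  have dn : d < n by have := ltn_ord (f v); lia.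
  rewrite E; apply/has_walkS; exists (g (Ordinal dn)); last first.
    by have := IH (g (Ordinal dn)); rewrite gK; apply.
  by rewrite -fadj gK /adj /= /path_adj /= E eqxx orbT.
(* An edge changes the index by exactly one, so no walk to [w] is shorter than [f v]. *)
move=> e; elim: e v => [|e IH] v; first by rewrite has_walk0 => /eqP->; lia.
case/has_walkS=> z; rewrite -fadj => vz /IH.
by move: vz; rewrite /adj /= /path_adj; lia.
Qed.

Lemma isomorphic_path (w : G) (f : G -> nat) :
  (forall v, dist v w = Some (f v)) -> injective f ->
  isomorphic G (path_graph n).
Proof.
move=> fE f_inj.
have down v d : d <= f v -> exists u, f u = d.
  move: {2}(f v) (erefl (f v)) => m; elim: m v => [|m IH] v E.
    by rewrite E leqn0 => /eqP->; exists v.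
  rewrite leq_eqVlt E => /orP[/eqP->|]; first by exists v.
  have := fE v; rewrite E => /distS[z _]; rewrite fE => -[zm].
  by rewrite ltnS -zm; apply: IH.
(* By [down], all of 0, ..., [f v] are values of [f], which has at most [n] of them. *)
have f_lt v : f v < n.
  rewrite -(size_iota 0 (f v).+1) -Gn cardE -(size_map f).
  apply: uniq_leq_size (iota_uniq _ _) _ => d; rewrite mem_iota => /down[u <-].
  by rewrite map_f ?mem_enum.
exists (fun v => Ordinal (f_lt v) : path_graph n).
  apply: inj_card_bij; last by rewrite card_ord Gn.
  by move=> x y [] /f_inj.
(* The next vertex on a shortest walk from [x] to [w] has the same value as [y], hence is [y]. *)
have adjS x y : f x = (f y).+1 -> adj x y.
  move=> E; have := fE x; rewrite E => /distS[z xz]; rewrite fE => -[].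
  by move/f_inj <-.
have adj_le x y : adj x y -> f x <= (f y).+1.
  by move=> xy; have [e] := dist_adj xy (fE y); rewrite fE => -[<-].
move=> x y; rewrite {1}/adj /= /path_adj /=; apply/orP/idP.
  by case=> /eqP/esym/adjS //; rewrite adj_sym.
move=> xy; have := adj_le _ _ xy; have := xy; rewrite adj_sym => /adj_le.
(* Values at adjacent vertices differ by at most one, and by injectivity they are distinct. *)
have: f x <> f y by move/f_inj=> E; rewrite E adj_irr in xy.
by lia.
Qed.

Lemma gamma_r_eq1 k : 0 < n ->
  gamma_r G k = 1 <-> n <= k.+1 /\ isomorphic G (path_graph n).
Proof.
move=> n0; split.
  have [[D /andP[resD domD] <-] _] := gamma_rP G k.
  move/eqP/cards1P=> [w Dw]; subst D.
  (* The default 0 never arises: [domw] makes every distance to [w] finite. *)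
  pose f v := odflt 0 (dist v w).
  have domw v : dist_le (dist v w) k.
    have [->|vw] := eqVneq v w; first by rewrite distxx.
    have /forall_inP/(_ v) := domD; rewrite !inE => /(_ vw)/exists_inP[x].
    by rewrite inE => /eqP->.
  have fE v : dist v w = Some (f v) by rewrite /f; case: dist (domw v).
  have f_le v : f v < k.+1 by have := domw v; rewrite fE.
  (* Resolving separates only vertices other than [w]; [w] itself is the only vertex at distance
     0. *)
  have f_inj : injective f.
    move=> u v Euv; apply/eqP; apply: contraT => uv.
    have fw : f w = 0 by rewrite /f distxx.
    have f0 x : f x = 0 -> x = w by move=> E; apply: dist_eq0; rewrite fE E.
    have [Eu|uw] := eqVneq u w.
      by rewrite Eu [v]f0 ?eqxx // -?Euv ?Eu in uv.
    have [Ev|vw] := eqVneq v w.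
      by rewrite Ev [u]f0 ?eqxx // ?Euv ?Ev in uv.
    have /forall_inP/(_ u) := resD; rewrite !inE => /(_ uw)/forall_inP/(_ v).
    by rewrite !inE => /(_ vw); rewrite uv /dist_vector enum_set1 /= !fE Euv eqxx.
  split; last exact: isomorphic_path fE f_inj.
  rewrite -Gn -[k.+1]card_ord; apply: (@leq_card _ _ (fun v => Ordinal (f_le v))).
  by move=> u v [] /f_inj.
case=> nk [f f_bij fadj]; have [g fK gK] := f_bij.
(* The witness is the end of the path with index 0, from which distances are the indices, at most
   [n.-1] and hence at most [k]. *)
pose w := g (Ordinal n0); have fw : f w = 0 :> nat by rewrite gK.
have dE := dist_path f_bij fadj fw.
apply/eqP; rewrite eqn_leq gamma_r_gt0 ?Gn // andbT -(cards1 w).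
have [_ ->//] := gamma_rP G k; apply/andP; split.
  apply/forall_inP=> u _; apply/forall_inP=> v _; apply/implyP.
  apply: contra_neq; rewrite /dist_vector enum_set1 /= !dE => -[E].
  exact/(can_inj fK)/val_inj.
apply/forall_inP=> u _; apply/exists_inP; exists w; rewrite ?inE // dE /=.
by have := ltn_ord (f u); lia.
Qed.

End Paths.

(** * Complements *)

Section Complements.
Variable G : sgraph.

Lemma edgeless_compl : edgeless (compl_graph G) <-> complete G.
Proof.
split=> cG x y => [xy|].
  by have := cG x y; rewrite /= /compl_adj xy negbK.
by rewrite /= /compl_adj negb_and !negbK; case: eqVneq => //= /cG.
Qed.

Lemma complete_compl : edgeless G -> complete (compl_graph G).
Proof. by move=> eG x y xy; rewrite /= /compl_adj xy eG. Qed.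

Lemma isomorphic_edgeless n :
  #|G| = n -> isomorphic G (edgeless_graph n) <-> edgeless G.
Proof.
move=> Gn; split=> [[f _ fadj] x y|eG]; first by rewrite -fadj.
have cardE : #|G| = #|'I_n| by rewrite card_ord.
exists (fun x => cast_ord Gn (enum_rank x)).
  by apply: inj_card_bij; [move=> x y /cast_ord_inj/enum_rank_inj | rewrite cardE].
by move=> x y; rewrite (negPf (eG x y)).
Qed.

Lemma isomorphic_complete n :
  #|G| = n -> isomorphic G (complete_graph n) <-> complete G.
Proof.
move=> Gn; split=> [[f f_bij fadj] x y xy|cG].
  by rewrite -fadj /= /complete_adj (inj_eq (bij_inj f_bij)).
have cardE : #|G| = #|'I_n| by rewrite card_ord.
have f_inj : injective (fun x : G => cast_ord Gn (enum_rank x)).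
  by move=> x y /cast_ord_inj/enum_rank_inj.
exists (fun x => cast_ord Gn (enum_rank x)).
  by apply: inj_card_bij => //; rewrite cardE.
move=> x y; rewrite /= /complete_adj (inj_eq f_inj).
by case: eqVneq => [->|/cG//]; rewrite adj_irr.
Qed.

Lemma isomorphic_compl (H : sgraph) :
  isomorphic (compl_graph G) H <-> isomorphic G (compl_graph H).
Proof.
split=> -[f f_bij fadj]; exists f => // x y.
  have := fadj x y; rewrite /= /compl_adj (inj_eq (bij_inj f_bij)) => ->.
  by rewrite /compl_adj; case: eqVneq => [->|_] /=; rewrite ?adj_irr ?negbK.
rewrite /= /compl_adj -fadj /= /compl_adj (inj_eq (bij_inj f_bij)).
case: eqVneq => [->|_] /=; rewrite ?adj_irr ?negbK //.
Qed.

Lemma path_compl_path n : 1 < n ->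
  isomorphic G (path_graph n) -> isomorphic (compl_graph G) (path_graph n) ->
  n = 4.
Proof.
move=> n1 [f [f' fK f'K] fadj] [g [g' gK g'K] gadj].
have gcompl x y : (f x : nat) != f y -> ~~ path_adj (f x) (f y) ->
    path_adj (g x) (g y).
  move=> xy nxy; have := gadj x y; rewrite /= /compl_adj -fadj => ->.
  by rewrite nxy andbT; apply: contraNneq xy => ->.
have [n_le3|n_gt3] := leqP n 3.
  (* The vertex of index 1 is adjacent to all others when [n] is 2 or 3, so it is isolated in the
     complement; yet every vertex of a path on at least two vertices has a neighbour. *)
  pose x : G := f' (Ordinal n1).
  have fx : f x = 1 :> nat by rewrite f'K.
  have [y gxy] : exists y, path_adj (g x) (g y).
    have [gx0|gx0] := posnP (g x : nat).
      by exists (g' (Ordinal n1)); rewrite g'K /path_adj /= gx0.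
    have lt : (g x).-1 < n by have := ltn_ord (g x); lia.
    by exists (g' (Ordinal lt)); rewrite g'K /path_adj /= prednK // eqxx orbT.
  have := gadj x y; rewrite [X in X = _]gxy /= /compl_adj -fadj /= => /esym/andP[].
  case: eqVneq => // xy _; rewrite /path_adj fx.
  have : (f y : nat) <> 1.
    by rewrite -fx => /val_inj/(can_inj fK) E; rewrite E eqxx in xy.
  by have := ltn_ord (f y); lia.
have [n4|n_gt4] : n = 4 \/ 4 < n by lia.
  by [].
(* [Ordinal (ltnW n1)] is index 0, an end of the path. In the complement it is adjacent to the
   vertices of indices 2, 3 and 4, but a path has no vertex with three neighbours. *)
have nbr (i : 'I_n) : 1 < i -> path_adj (g (f' (Ordinal (ltnW n1)))) (g (f' i)).
  by move=> i1; apply: gcompl; rewrite !f'K /path_adj /=; lia.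
have l2 : 2 < n by lia.
have := nbr (Ordinal l2) isT; have := nbr (Ordinal n_gt3) isT.
have := nbr (Ordinal n_gt4) isT.
have gneq (i j : 'I_n) : (i : nat) != j -> (g (f' i) : nat) != g (f' j).
  by apply: contra_neq => /val_inj/(can_inj gK)/(can_inj f'K)->.
have := gneq (Ordinal l2) (Ordinal n_gt3) isT.
have := gneq (Ordinal l2) (Ordinal n_gt4) isT.
have := gneq (Ordinal n_gt3) (Ordinal n_gt4) isT.
by rewrite /path_adj; lia.
Qed.

End Complements.

(** * Small paths and their complements *)

Lemma isomorphic_path2 (G : sgraph) :
  isomorphic G (path_graph 2) <-> isomorphic G (complete_graph 2).
Proof.
have adj2 (i j : 'I_2) : path_adj i j = complete_adj i j.
  by case: i j => [[|[|i]] //= ?] [[|[|j]] //= ?].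
by split=> -[f f_bij fadj]; exists f => // x y; rewrite -fadj /= adj2.
Qed.

Lemma isomorphic_compl_path2 (G : sgraph) : #|G| = 2 ->
  isomorphic (compl_graph G) (path_graph 2) <-> isomorphic G (edgeless_graph 2).
Proof.
move=> G2; have -> : isomorphic G (edgeless_graph 2) <-> edgeless G.
  exact: isomorphic_edgeless.
rewrite isomorphic_path2 (@isomorphic_complete (compl_graph G) 2 G2).
split=> [cG x y|]; last exact: complete_compl.
by have [->|/cG/andP[]//] := eqVneq x y; rewrite adj_irr.
Qed.

Lemma isomorphic_compl_path4 (G : sgraph) :
  isomorphic G (path_graph 4) -> isomorphic (compl_graph G) (path_graph 4).
Proof.
case=> f f_bij fadj; apply/isomorphic_compl.
(* The non-edges 13, 30, 02 of the path on four vertices form the path 1, 3, 0, 2. *)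
pose s (i : 'I_4) : 'I_4 := inord (nth 0 [:: 1; 3; 0; 2] i).
have sE i : s i = nth 0 [:: 1; 3; 0; 2] i :> nat.
  by rewrite inordK //; case: i => [[|[|[|[|i]]]]].
have s_inj : injective s.
  move=> i j /(congr1 val) /=; rewrite !sE => E; apply: val_inj; move: E.
  by case: i j => [[|[|[|[|i]]]] //= ?] [[|[|[|[|j]]]] //= ?].
have s_bij : bijective s by apply: injF_bij.
exists (s \o f); first exact: bij_comp s_bij f_bij.
move=> x y; rewrite -fadj /= /compl_adj /= (inj_eq s_inj) /path_adj !sE.
case: (f x) (f y) => [[|[|[|[|i]]]] //= ?] [[|[|[|[|j]]]] //= ?].
Qed.

(** * Bounds for a graph and its complement *)

(** If one value is [#|G|], that graph is edgeless and the other complete, which fixes the second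
    value. Otherwise both are smaller, which keeps sum and product strictly below their upper
    bounds. *)
Lemma gamma_r_compl_upper (G : sgraph) (k : nat) : 0 < k -> 1 < #|G| ->
  let a := gamma_r G k in let b := gamma_r (compl_graph G) k in
  (edgeless G \/ complete G) /\ (a + b = 2 * #|G| - 1 /\ a * b = #|G| * (#|G| - 1))
  \/ ~ (edgeless G \/ complete G) /\ a < #|G| /\ b < #|G|.
Proof.
move=> k0 G1 a b; have G0 : 0 < #|G| by lia.
have aE : a = #|G| <-> edgeless G by exact: gamma_r_eq_card.
have bE : b = #|G| <-> complete G.
  by rewrite -edgeless_compl; apply: (@gamma_r_eq_card (compl_graph G)).
have a_le : a <= #|G| := gamma_r_le_card G k.
have b_le : b <= #|G| := gamma_r_le_card (compl_graph G) k.
have [aG|aG] := eqVneq a #|G|.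
  left; have eG := aE.1 aG; split; first by left.
  have -> : b = #|G|.-1.
    exact: (@gamma_r_complete (compl_graph G) k k0 G1 (complete_compl eG)).
  by rewrite aG subn1; split=> //; lia.
have [bG|bG] := eqVneq b #|G|.
  left; have cG := bE.1 bG; split; first by right.
  have -> : a = #|G|.-1 by apply: gamma_r_complete.
  by rewrite bG mulnC subn1; split=> //; lia.
right; split; first by case=> [/aE|/bE] /eqP; [rewrite (negPf aG)|rewrite (negPf bG)].
by split; lia.
Qed.

Lemma mul_eq1 (a b : nat) : a * b = 1 <-> a = 1 /\ b = 1.
Proof. by split=> [/eqP|[-> ->//]]; rewrite muln_eq1 => /andP[/eqP-> /eqP->]. Qed.

Lemma mul_eq2 (a b : nat) : 0 < a -> 0 < b -> a * b = 2 <-> a + b = 3.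
Proof.
move=> a0 b0; split; last by move=> E; have [[-> ->]|[-> ->]] : a = 1 /\ b = 2 \/ a = 2 /\ b = 1 by lia.
by case: a b a0 b0 => [|[|[|a]]] [|[|[|b]]] //=; nia.
Qed.

Theorem theorem6p1 (G : sgraph) (n : nat) (hG : #|G| = n) (hn : 2 <= n) :
  [/\ 3 <= gamma_r G 2 + gamma_r (compl_graph G) 2 <= 2 * n - 1,
      2 <= gamma_r G 2 * gamma_r (compl_graph G) 2 <= n * (n - 1),
      (gamma_r G 2 + gamma_r (compl_graph G) 2 = 3 <->
         [\/ isomorphic G (complete_graph 2),
             isomorphic G (edgeless_graph 2),
             isomorphic G (path_graph 3)
           | isomorphic G (compl_graph (path_graph 3))])
      /\ (gamma_r G 2 * gamma_r (compl_graph G) 2 = 2 <->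
         [\/ isomorphic G (complete_graph 2),
             isomorphic G (edgeless_graph 2),
             isomorphic G (path_graph 3)
           | isomorphic G (compl_graph (path_graph 3))])
    & (gamma_r G 2 + gamma_r (compl_graph G) 2 = 2 * n - 1 <->
         isomorphic G (complete_graph n) \/ isomorphic G (edgeless_graph n))
      /\ (gamma_r G 2 * gamma_r (compl_graph G) 2 = n * (n - 1) <->
         isomorphic G (complete_graph n) \/ isomorphic G (edgeless_graph n))]
  /\
  forall k : nat, 3 <= k ->
  [/\ 2 <= gamma_r G k + gamma_r (compl_graph G) k <= 2 * n - 1,
      1 <= gamma_r G k * gamma_r (compl_graph G) k <= n * (n - 1),
      (gamma_r G k + gamma_r (compl_graph G) k = 2 <->
         isomorphic G (path_graph 4))
      /\ (gamma_r G k * gamma_r (compl_graph G) k = 1 <->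
         isomorphic G (path_graph 4))
    & (gamma_r G k + gamma_r (compl_graph G) k = 2 * n - 1 <->
         isomorphic G (complete_graph n) \/ isomorphic G (edgeless_graph n))
      /\ (gamma_r G k * gamma_r (compl_graph G) k = n * (n - 1) <->
         isomorphic G (complete_graph n) \/ isomorphic G (edgeless_graph n))].
Proof.
have n0 : 0 < n by lia.
have G1 : 1 < #|G| by rewrite hG.
have upper k : 0 < k ->
    let a := gamma_r G k in let b := gamma_r (compl_graph G) k in
    [/\ a + b <= 2 * n - 1, a * b <= n * (n - 1)
      & (a + b = 2 * n - 1 <->
           isomorphic G (complete_graph n) \/ isomorphic G (edgeless_graph n))
        /\ (a * b = n * (n - 1) <->
           isomorphic G (complete_graph n) \/ isomorphic G (edgeless_graph n))].
  move=> k0 a b.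
  have isoC := isomorphic_complete hG; have isoE := isomorphic_edgeless hG.
  have := gamma_r_compl_upper k0 G1; rewrite -/a -/b hG.
  case=> [[ec [-> ->]]|[nec [an bn]]].
    by split=> //; split; split=> // _; tauto.
  (* Both factors are at most [n.-1], which is positive. *)
  have ab : a * b < n * (n - 1).
    apply: (@leq_ltn_trans (n.-1 * n.-1)); first by apply: leq_mul; lia.
    by rewrite subn1 ltn_mul2r; lia.
  by split; [lia | exact: ltnW | split; split=> [E|]; [lia|tauto|lia|tauto]].
have pos k : 0 < gamma_r G k /\ 0 < gamma_r (compl_graph G) k.
  by split; apply: gamma_r_gt0; rewrite ?hG.
have G_eq1 k := gamma_r_eq1 hG k n0.
have cG_eq1 k := @gamma_r_eq1 (compl_graph G) n hG k n0.
have both1 k : gamma_r G k = 1 -> gamma_r (compl_graph G) k = 1 ->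
    n = 4 /\ isomorphic G (path_graph n).
  by move=> /G_eq1[_ Gp] /cG_eq1[_ cGp]; split=> //; apply: path_compl_path Gp cGp.
split.
  have [a0 b0] := pos 2; have [s_le p_le s_p] := upper 2 isT.
  set a := gamma_r G 2 in a0 b0 s_le p_le s_p *.
  set b := gamma_r (compl_graph G) 2 in b0 s_le p_le s_p *.
  (* Both being 1 would force [n = 4], while [gamma_r_eq1] with [k = 2] gives [n <= 3]. *)
  have not_both : a = 1 -> b <> 1.
    by move=> a1 b1; have [n4 _] := both1 2 a1 b1; have [] := (G_eq1 2).1 a1; lia.
  have s_ge : 3 <= a + b by lia.
  have s3 : a + b = 3 <-> a = 1 \/ b = 1.
    split; first by lia.
    (* Now [n <= 3]. If neither graph is edgeless, both values are below 3 and not both 1. Otherwise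
       the sum is [2 * n - 1], and a value 1 beside one at most [n] leaves only [n = 2]. *)
    have n3 : a = 1 \/ b = 1 -> n <= 3 by case=> [/G_eq1|/cG_eq1] [].
    move=> ab; have := n3 ab.
    have a_le : a <= n by rewrite -hG; apply: gamma_r_le_card.
    have b_le : b <= n by rewrite -hG; apply: (gamma_r_le_card (compl_graph G)).
    have := gamma_r_compl_upper (isT : 0 < 2) G1; rewrite -/a -/b hG; lia.
  have s_iso : a + b = 3 <->
      [\/ isomorphic G (complete_graph 2), isomorphic G (edgeless_graph 2),
          isomorphic G (path_graph 3)
        | isomorphic G (compl_graph (path_graph 3))].
    rewrite s3 (G_eq1 2) (cG_eq1 2); split.
      (* Only [n = 2] and [n = 3] remain; for [n = 2] the path is the complete graph. *)
      have [n2|n2] := eqVneq n 2.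
        move: hG; rewrite n2 => G2.
        rewrite isomorphic_path2 isomorphic_compl_path2 // => -[[_ ?]|[_ ?]].
          by constructor 1.
        by constructor 2.
      case=> -[n3]; have -> : n = 3 by lia.
        by constructor 3.
      by move/isomorphic_compl; constructor 4.
    case=> Giso; have := isomorphic_card Giso; rewrite hG card_ord => nE.
    - by left; rewrite nE; split=> //; apply/isomorphic_path2.
    - by right; rewrite nE; split=> //; apply/isomorphic_compl_path2; rewrite ?hG.
    - by left; rewrite nE.
    - by right; rewrite nE; split=> //; apply/isomorphic_compl.
  split; rewrite ?s_ge ?s_le ?p_le ?andbT //.
    have : a * b <> 1 by move/mul_eq1=> [/not_both].
    have : 0 < a * b by rewrite muln_gt0 a0.
    by lia.
  by split=> //; rewrite mul_eq2.
move=> k k3; have [a0 b0] := pos k; have [|s_le p_le s_p] := upper k; first by lia.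
(* For [k >= 3] the bound [n <= k.+1] admits [n = 4], and the path on four vertices is
   self-complementary. *)
have P4 : gamma_r G k = 1 /\ gamma_r (compl_graph G) k = 1 <->
    isomorphic G (path_graph 4).
  split=> [[a1 b1]|Gp]; first by have [<-] := both1 k a1 b1.
  have nE : n = 4 by rewrite -hG (isomorphic_card Gp) card_ord.
  rewrite (G_eq1 k) (cG_eq1 k) nE.
  by do ![split] => //; apply: isomorphic_compl_path4.
split; rewrite ?s_le ?p_le ?andbT ?muln_gt0 ?a0 ?b0 //; first by lia.
rewrite mul_eq1 -P4; split=> //; split; lia.
Qed.
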